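(* For each pair $\mu,\nu$ of integer partitions, there exists a polynomial $b_{\mu\nu}(t)$ in one variable $t$ with nonnegative integer coefficients such that, with $n=|\nu|$, $$\sigma(\mu,\Delta)=(q-1)^{\sum_{j\geq 2}\mu_j}\,q^{\sum_{j\geq 2}\binom{\mu_j}{2}}\,b_{\mu\nu}(q)$$ for every prime power $q$ and every diagonal matrix $\Delta\in \mathrm{M}_n(\mathbb{F}_q)$ of type $\nu$.
   Context: $\mathbb{F}_q$ is the finite field with $q$ elements and $\mathrm{M}_n(\mathbb{F}_q)$ is the space of $n\times n$ matrices over $\mathbb{F}_q$. An integer partition is a weakly decreasing sequence $\mu=(\mu_1,\mu_2,\ldots)$ of nonnegative integers with finite sum $|\mu|$. Given $\Delta\in\mathrm{M}_n(\mathbb{F}_q)$, a subspace $W\subseteq\mathbb{F}_q^n$ has $\Delta$-profile $\mu$ if $\dim(W+\Delta W+\cdots+\Delta^{j-1}W)=\mu_1+\cdots+\mu_j$ for all $j\ge 1$. $\sigma(\mu,\Delta)$ denotes the number of subspaces of $\mathbb{F}_q^n$ with $\Delta$-profile $\mu$. The type of a diagonal matrix is the integer partition obtained by listing the multiplicities of its distinct diagonal entries in weakly decreasing order. *)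

(* Defs.v *)
From HB Require Import structures.
From mathcomp Require Import all_boot all_order all_algebra.
From mathcomp Require Import boolp.

Set Implicit Arguments.
Unset Strict Implicit.
Unset Printing Implicit Defensive.

Import GRing.Theory.
Local Open Scope ring_scope.

(* A vector space over a finite field has finitely many subspaces.  The       *)
(* library represents a subspace by a canonical matrix but declares no        *)
(* finType structure on {vspace vT}, which cardinals of sets of subspaces     *)
(* require.                                                                   *)
HB.instance Definition _ (F : finFieldType) (vT : vectType F) :=
  Choice_isCountable.Build {vspace vT}
    (pcan_pickleK (can_pcan (@VectorInternalTheory.vs2mxK F vT))).
HB.instance Definition _ (F : finFieldType) (vT : vectType F) :=
  isFinite.Build {vspace vT}
    (pcan_enumP (can_pcan (@VectorInternalTheory.vs2mxK F vT))).

(* An integer partition is encoded by the list of its nonzero parts, in       *)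
(* weakly decreasing order; the infinite tail of zeros is dropped, so that    *)
(* each partition has exactly one encoding.  The part mu_j (j >= 1) is        *)
(* nth 0 mu (j - 1), and |mu| is sumn mu.                                     *)
Definition is_intpart (mu : seq nat) : bool :=
  sorted geq mu && (0%N \notin mu).

Section Profile.
Variables (F : finFieldType) (n : nat).
Implicit Types (D : 'M[F]_n) (W : {vspace 'cV[F]_n}).

Definition krylov D W (j : nat) : {vspace 'cV[F]_n} :=
  (\sum_(i < j) (linfun (mulmx (D ^+ i)) @: W))%VS.

Definition has_profile (mu : seq nat) D W : Prop :=
  forall j : nat, (0 < j)%N ->
    \dim (krylov D W j) = (\sum_(i < j) nth 0 mu i)%N.

(* has_profile quantifies over all j, so it is turned into a boolean          *)
(* predicate by classical decidability.                                       *)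
Definition sigma (mu : seq nat) D : nat :=
  #|[set W : {vspace 'cV[F]_n} | `[< has_profile mu D W >]]|.

Definition diag_entries D : seq F := [seq D i i | i <- enum 'I_n].

Definition diag_type D : seq nat :=
  sort geq [seq count_mem a (diag_entries D) | a <- undup (diag_entries D)].

End Profile.

(* Main.v *)
Require Import Defs.
From HB Require Import structures.
From mathcomp Require Import all_boot all_order all_algebra.
From mathcomp Require Import finfield boolp zify ring.

(* Fix eigenvalue a, subtract a from Delta (profiles do not change), and write
   the sum of the eigenspaces as A + E, where E is the a-eigenspace and Delta is
   injective on A.  A subspace W of A + E is given by its projection W' to A, by
   K = W :&: E and by a linear map h from W' to a complement of K in E; W is then
   K plus the graph of h.  If W' has profile la, then the subspaces
   W' :&: Delta (W' + ... + Delta^(j-1) W') form a flag of W' with dimensions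
   la_1 - la_(j+1), and W has profile mu iff dim K = mu_1 - la_1 and h has rank
   sum_(2 <= i <= j + 1) (mu_i - la_i) on the j-th step of this flag.  So the
   number of W above W' depends only on la, mu, dim E and q, and counting the
   maps h one basis vector at a time gives products of q-binomials and of factors
   q^M - q^r = (q - 1) q^r (1 + q + ... + q^(M-r-1)).  The powers of q - 1 and q
   collected along the induction on the number of eigenvalues add up, by
   summation by parts, to exactly those of the theorem. *)

Set Implicit Arguments.
Unset Strict Implicit.
Unset Printing Implicit Defensive.

Import GRing.Theory.
Local Open Scope nat_scope.

(** * q-integers and tuples of vectors *)

Definition qint (q n : nat) : nat := \sum_(i < n) q ^ i.

(** Gaussian binomials by the q-Pascal rule, without division, so that they are visibly polynomials
    in [q] with nonnegative coefficients. *)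
Fixpoint qbin (q m k : nat) : nat :=
  match m, k with
  | _, 0 => 1
  | 0, _.+1 => 0
  | m'.+1, k'.+1 => qbin q m' k' + q ^ k * qbin q m' k
  end.

Lemma qbin0 q m : qbin q m 0 = 1. Proof. by case: m. Qed.

Lemma qbin_small q m k : m < k -> qbin q m k = 0.
Proof.
elim: m k => [|m IHm] [|k] //= mk.
by rewrite !IHm ?muln0 //; lia.
Qed.

Lemma qintD q m n : qint q (m + n) = qint q m + q ^ m * qint q n.
Proof.
rewrite /qint big_split_ord /= big_distrr /=; congr addn.
by apply: eq_bigr => i _; rewrite expnD.
Qed.

(** This is where the factors [q - 1] come from. For [m <= n] truncated subtraction makes both sides
    0. *)
Lemma expn_sub_qint q m n : 0 < q -> q ^ m - q ^ n = (q - 1) * q ^ n * qint q (m - n).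
Proof.
move=> q_gt0; case: (leqP m n) => [mn | /ltnW nm].
  have := leq_pexp2l q_gt0 mn; rewrite /qint (eqP mn) big_ord0; lia.
rewrite -{1}(subnKC nm) expnD; have := predn_exp q (m - n); rewrite -/(qint _ _) => E.
by rewrite -{2}[q ^ n]muln1 -mulnBr [q - 1]subn1 mulnC -mulnA (mulnC _ (qint _ _)) mulnA -E subn1 mulnC.
Qed.

Lemma qbin_qfact q m k :
  qbin q m k * \prod_(i < k) qint q i.+1 = \prod_(i < k) qint q (m - i).
Proof.
elim: m k => [|m IHm] [|k]; rewrite ?big_ord0 ?muln1 //=.
  by rewrite mul0n big_ord_recl /= /qint big_ord0.
have IH := IHm k; have IHS := IHm k.+1; rewrite !big_ord_recr /= in IHS.
rewrite big_ord_recr /= mulnDl mulnA IH -mulnA IHS.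
rewrite [RHS]big_ord_recl /= (eq_bigr (fun i : 'I_k => qint q (m - i))); last first.
  by move=> i _; congr qint; rewrite /= /bump; lia.
rewrite (mulnCA (q ^ k.+1)) -mulnDr mulnC subn0.
case: (leqP k m) => [km | mk].
  by rewrite -qintD addSn subnKC.
by rewrite (bigD1 (Ordinal mk)) //= subnn /qint big_ord0 !(mul0n, muln0).
Qed.

(* The number of ways to append [a] vectors of an [M]-dimensional space to a
   family of rank [r] so that the rank becomes [r + e]. *)
Definition qext (q M r a e : nat) : nat :=
  q ^ ((a - e) * r) * qbin q a e * \prod_(i < e) (q ^ M - q ^ (r + i)).

Lemma qext_rec0 q M r a : qext q M r a.+1 0 = qext q M r a 0 * q ^ r.
Proof. by rewrite /qext !subn0 !qbin0 mulSn expnD !big_ord0 !muln1 mulnC. Qed.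

(** The last vector either lies in the span of the earlier ones or is one of the
    [q ^ M - q ^ (r + e)] vectors that raise the rank. *)
Lemma qext_recS q M r a e :
  qext q M r a.+1 e.+1 =
    qext q M r a e.+1 * q ^ (r + e.+1) + qext q M r a e * (q ^ M - q ^ (r + e)).
Proof.
rewrite /qext /= subSS !big_ord_recr /=; move: (q ^ M - q ^ (r + e)) (\prod_(i < e) _) => x P.
have [ae | ea] := leqP a e.
  by rewrite (@qbin_small q a e.+1) ?ltnS // !(muln0, mul0n, addn0, add0n) !mulnA.
have -> : (a - e) * r = (a - e.+1) * r + r by rewrite -mulSnr subnSK.
by rewrite (expnD _ r) (expnD _ ((a - e.+1) * r)); ring.
Qed.

Section TupleCount.
Variables (F : finFieldType) (n : nat).
Notation V := 'cV[F]_n.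
Notation q := #|F|.
Implicit Types (C U : {vspace V}) (c : seq V) (P Q : pred (seq V)).

(** The predicate is on sequences, so that one condition applies to tuples of every length and to
    their prefixes. *)
Definition ntuples (L : nat) P : nat := \sum_(c : L.-tuple V) (P c : nat).

Lemma eq_ntuples L P Q : (forall c, size c = L -> P c = Q c) ->
  ntuples L P = ntuples L Q.
Proof. by move=> PQ; apply: eq_bigr => c _; rewrite PQ ?size_tuple. Qed.

Lemma ntuples0 P : ntuples 0 P = P [::].
Proof.
rewrite /ntuples (bigD1 [tuple]) //= big1 ?addn0 // => c.
by rewrite (tuple0 c) => /eqP.
Qed.

Lemma ntuplesS L P : ntuples L.+1 P =
  \sum_(c : L.-tuple V) \sum_(x : V) (P (rcons c x) : nat).
Proof.
rewrite pair_big /= /ntuples.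
rewrite (reindex (fun p : L.-tuple V * V => [tuple of rcons p.1 p.2])) //=.
exists (fun c : L.+1.-tuple V => ([tuple of belast (thead c) (behead c)], last (thead c) (behead c))).
  move=> [c x] _; set t := [tuple of rcons c x].
  have := lastI (thead t) (behead t).
  have <- : tval t = thead t :: behead t by rewrite [in LHS](tuple_eta t).
  by move=> /rcons_inj [E1 E2]; congr pair; first apply: val_inj.
move=> c _; apply: val_inj => /=.
by case/tupleP: c => a c; rewrite theadE /= -lastI.
Qed.

Lemma card_vspace_col U : #|[set x : V | x \in U]| = q ^ \dim U.
Proof. by rewrite cardsE card_vspace. Qed.

Lemma dim_span_rcons c x : \dim <<rcons c x>> = (x \notin <<c>>%VS) + \dim <<c>>.
Proof.
have -> : (<<rcons c x>> = <<x :: c>>)%VS by apply: eq_span => y; rewrite mem_rcons.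
rewrite span_cons; case: (boolP (x \in _)) => [xc | xNc] /=.
  by congr (\dim _); apply/addv_idPr; rewrite -memvE.
rewrite dimv_disjoint_sum ?dim_vline.
  by have -> : x != 0%R by apply: contraNneq xNc => ->; rewrite mem0v.
apply/eqP; rewrite -subv0; apply/subvP => y /memv_capP [/vlineP [k ->]].
  have [-> | k0] := eqVneq k 0%R; first by rewrite scale0r !mem0v.
by move=> /(memvZ k^-1%R); rewrite scalerA mulVf // scale1r (negbTE xNc).
Qed.

Lemma count_extend C c e : all [in C] c ->
  \sum_(x : V) ((x \in C) && (\dim <<rcons c x>> == e) : nat) =
    (\dim <<c>> == e) * q ^ e +
    ((\dim <<c>>).+1 == e) * (q ^ \dim C - q ^ e.-1).
Proof.
move=> /allP cC.
have sub : (<<c>> <= C)%VS by apply/span_subvP => x /cC.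
rewrite -big_mkcond sum1dep_card.
have [<- | ne] := eqVneq (\dim <<c>>) e.
  rewrite gtn_eqF // mul1n addn0 -card_vspace_col; apply: eq_card => x.
  rewrite !inE dim_span_rcons -{2}(add0n (\dim _)) eqn_add2r eqb0 negbK.
  by apply: andb_idl => /(subvP sub).
have [<- | ne'] := eqVneq (\dim <<c>>).+1 e.
  rewrite mul1n /= -!card_vspace_col.
  have := cardsID [set x : V | x \in <<c>>%VS] [set x : V | x \in C].
  have -> : [set x | x \in C] :&: [set x | x \in <<c>>%VS] = [set x | x \in <<c>>%VS].
    by apply/setP => x; rewrite !inE; apply: andb_idl => /(subvP sub).
  move=> <-; rewrite add0n addKn; apply: eq_card => x.
  rewrite !inE dim_span_rcons.
  by case: (x \in <<c>>%VS); rewrite /= ?add0n ?add1n ?eqxx ?andbT ?ltn_eqF ?andbF.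
rewrite !mul0n addn0; apply: eq_card0 => x.
rewrite !inE dim_span_rcons; apply/negbTE; rewrite negb_and.
by case: (x \in <<c>>%VS) => /=; rewrite ?add0n ?add1n ?ne ?ne' orbT.
Qed.

(** Induction on [a]: removing the last vector gives the recursion of [qext], and [Q] is unaffected
    because it sees only the first [L] vectors. *)
Lemma ntuples_extend C Q L a r e :
  ntuples (L + a) (fun c => [&& Q (take L c), all [in C] c,
     \dim <<take L c>> == r & \dim <<c>> == r + e]) =
  ntuples L (fun c => [&& Q c, all [in C] c & \dim <<c>> == r]) *
    qext q (\dim C) r a e.
Proof.
elim: a e => [|a IHa] e.
  rewrite addn0; case: e => [|e].
    rewrite /qext big_ord0 mul0n !muln1; apply: eq_ntuples => c <-.
    by rewrite take_size addn0 andbb.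
  rewrite /qext /= muln0 mul0n muln0 /ntuples big1 // => c _.
  rewrite -[X in take X _](size_tuple c) take_size.
  by case: (_ =P r) => [->|]; rewrite ?andbF // [_ == r + _]ltn_eqF ?andbF //; lia.
rewrite addnS ntuplesS.
pose B c := [&& Q (take L c), all [in C] c & \dim <<take L c>> == r].
transitivity (\sum_(c : (L + a).-tuple V) (B c && (\dim <<c>> == r + e)) * q ^ (r + e) +
  \sum_(c : (L + a).-tuple V) (B c && ((\dim <<c>>).+1 == r + e)) * (q ^ \dim C - q ^ (r + e).-1)).
  rewrite -big_split /=; apply: eq_bigr => c _.
  have tk x : take L (rcons c x) = take L c.
    by rewrite -cats1 takel_cat // size_tuple leq_addr.
  case Bc: (B c); last first.
    rewrite !mul0n big1 // => x _; rewrite tk all_rcons.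
    move: Bc; rewrite /B; case: (Q _) => //=; case: (all _ _) => //=; rewrite ?andbF //.
    by move=> ->; rewrite !andbF.
  case/and3P: (Bc) => Qc cC rc.
  rewrite /= -count_extend //; apply: eq_bigr => x _.
  by rewrite tk Qc rc all_rcons cC andbT.
rewrite -!big_distrl /=.
have HB m : \sum_(c : (L + a).-tuple V) (B c && (\dim <<c>> == m)) =
   ntuples (L + a) (fun c => [&& Q (take L c), all [in C] c,
     \dim <<take L c>> == r & \dim <<c>> == m]).
  by apply: eq_bigr => c _; rewrite /B -!andbA.
rewrite HB IHa; case: e => [|e].
  (* The rank-raising term vanishes: the first [L] vectors already have rank [r]. *)
  rewrite addn0 [X in _ + X * _]big1 ?mul0n ?addn0 ?qext_rec0 ?mulnA // => c _.
  rewrite /B; case: (_.+1 =P r) => [h|]; rewrite ?andbF //.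
  have : \dim <<take L c>> <= \dim <<c>> by apply/dimvS/sub_span => x /mem_take.
  by case: (\dim <<take L c>> =P r) => [->|]; rewrite ?andbF //; lia.
rewrite (eq_bigr (fun c : (L + a).-tuple V => nat_of_bool (B c && (\dim <<c>> == r + e)))); last first.
  by move=> c _; rewrite addnS eqSS.
rewrite HB IHa qext_recS addnS /=; ring.
Qed.

End TupleCount.

(** * Counting subspaces, and tuples with prescribed ranks of prefixes *)

Lemma qbinnn q k : qbin q k k = 1.
Proof. by elim: k => //= k ->; rewrite qbin_small // muln0. Qed.

Section SubspaceCount.
Variables (F : finFieldType) (n : nat).
Notation V := 'cV[F]_n.
Notation q := #|F|.
Implicit Types (C K E : {vspace V}) (c : seq V).

Lemma ntuples_free E k :
  ntuples k (fun c : seq V => all [in E] c && (\dim <<c>> == k)) =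
    \prod_(i < k) (q ^ \dim E - q ^ i).
Proof.
have := @ntuples_extend F n E predT 0 k 0 k.
rewrite ntuples0 /qext subnn qbinnn !mul1n /= span_nil dimv0 mul1n => <-.
by apply: eq_ntuples => c _; rewrite /= take0 span_nil dimv0.
Qed.

(** Double counting of the free [k]-tuples in [E], each of which is a basis of exactly one
    [k]-dimensional subspace. *)
Lemma card_subspaces E k :
  #|[set K : {vspace V} | (K <= E)%VS && (\dim K == k)]| = qbin q (\dim E) k.
Proof.
have q_gt1 : 1 < q := finNzRing_gt1 F.
have D_gt0 : 0 < \prod_(i < k) (q ^ k - q ^ i).
  by apply: prodn_gt0 => i; rewrite subn_gt0 ltn_exp2l.
apply/eqP; rewrite -(eqn_pmul2r D_gt0); apply/eqP.
transitivity (\prod_(i < k) (q ^ \dim E - q ^ i)); last first.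
  under eq_bigr => i _ do rewrite expn_sub_qint 1?ltnW //.
  under [in RHS]eq_bigr => i _ do rewrite expn_sub_qint 1?ltnW //.
  rewrite big_split [in RHS]big_split /= [RHS]mulnCA; congr muln.
  rewrite -qbin_qfact; congr muln; rewrite (reindex_inj rev_ord_inj) /=.
  by apply: eq_bigr => i _; congr qint; have := ltn_ord i; lia.
rewrite -ntuples_free /ntuples -sum_nat_const.
rewrite (eq_bigr (fun K : {vspace V} =>
   \sum_(c : k.-tuple V) (<<c>>%VS == K : nat))); last first.
  move=> K; rewrite inE => /andP [_ /eqP dK].
  have := ntuples_free K k; rewrite dK => <-; apply: eq_bigr => c _; congr nat_of_bool.
  apply/andP/eqP => [[/allP cK /eqP dc]|cK]; last first.
  - by split; [apply/allP => x /memv_span | ]; rewrite cK ?dK.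
  - apply/eqP; rewrite eqEdim dK dc leqnn andbT; exact/span_subvP.
rewrite exchange_big /=; apply: eq_bigr => c _.
rewrite -big_mkcondr sum1dep_card /=.
have [/andP [/allP cE dc] | nc] := boolP (_ && _).
  apply: (@eq_card1 _ <<c>>%VS) => K; rewrite !inE [RHS]eq_sym; case: (<<c>>%VS =P K) => [<-|]; rewrite ?andbF //.
  by rewrite dc !andbT; apply/span_subvP.
apply: eq_card0 => K; rewrite !inE; apply: contraNF nc => /andP [/andP [KE dK] /eqP cK].
by rewrite cK dK andbT; apply/allP => x /memv_span; rewrite cK => /(subvP KE).
Qed.

(** The tuple is built block by block: the entries from [p j] to [p j.+1] raise the rank from
    [rho j] to [rho j.+1], which [ntuples_extend] counts. *)
Lemma ntuples_flag C (p rho : nat -> nat) s : p 0 = 0 -> rho 0 = 0 ->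
    (forall j, p j <= p j.+1) -> (forall j, rho j <= rho j.+1) ->
  ntuples (p s) (fun c => all [in C] c &&
      all (fun j => \dim <<take (p j) c>> == rho j) (iota 0 s.+1)) =
    \prod_(j < s) qext q (\dim C) (rho j) (p j.+1 - p j) (rho j.+1 - rho j).
Proof.
move=> p0 rho0 pS rhoS; elim: s => [|s IHs].
  by rewrite big_ord0 p0 ntuples0 /= ?p0 ?take0 span_nil dimv0 rho0.
have ple := homo_leq leqnn leq_trans pS.
rewrite big_ord_recr [in RHS]/= -IHs.
pose Q c := all (fun j => \dim <<take (p j) c>> == rho j) (iota 0 s.+1).
have Qs c : Q c -> \dim <<take (p s) c>> == rho s.
  by move=> /allP /(_ s); apply; rewrite mem_iota add0n ltnSn.
transitivity (ntuples (p s + (p s.+1 - p s)) (fun c => [&& Q (take (p s) c), all [in C] c,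
     \dim <<take (p s) c>> == rho s & \dim <<c>> == rho s + (rho s.+1 - rho s)])).
  rewrite !subnKC //; apply: eq_ntuples => c sc.
  have tk : take (p s.+1) c = c by rewrite -sc take_size.
  rewrite -(addn1 s.+1) (iotaD 0 s.+1 1) all_cat -/(Q c) add0n [all _ (iota _ 1)]/= andbT tk.
  have -> : Q (take (p s) c) = Q c.
    apply: eq_in_all => j; rewrite mem_iota => /andP [_ js].
    by rewrite take_takel // ple // -ltnS.
  rewrite [LHS]andbCA; case Qc: (Q c) => //=.
  by rewrite Qs.
rewrite ntuples_extend; congr muln; apply: eq_ntuples => c sc.
have tk : take (p s) c = c by rewrite -sc take_size.
rewrite -/(Q c) andbCA andbC; case Qc: (Q c); rewrite ?andbF ?andbT //.
by move: (Qs c Qc); rewrite tk => ->; rewrite andbT.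
Qed.

End SubspaceCount.

(** * Profiles in a sum A + E *)

(** Each step appends a basis of a complement. Ranks of a linear map on the flag become ranks of
    prefixes of its list of values. *)
Lemma adapted_basis (K : fieldType) (vT : vectType K) (A : nat -> {vspace vT}) s :
    (forall j, (A j <= A j.+1)%VS) ->
  exists b : seq vT, basis_of (A s) b /\
    forall j, j <= s -> <<take (\dim (A j)) b>>%VS = A j.
Proof.
move=> AS; elim: s => [|s [b [bA bt]]].
  exists (vbasis (A 0)); split; first exact: vbasisP.
  move=> [|//] _; rewrite -{1}(size_tuple (vbasis (A 0))) take_size.
  by rewrite (span_basis (vbasisP _)).
pose b' := b ++ vbasis (A s.+1 :\: A s)%VS.
have bA' : basis_of (A s.+1) b'.
  have <- : (A s + (A s.+1 :\: A s) = A s.+1)%VS.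
    by rewrite addvC addv_diff; apply/addv_idPl.
  apply: cat_basis; rewrite ?bA ?vbasisP //.
  by apply/directv_addP; rewrite capvC capv_diff.
have szb : size b = \dim (A s) by rewrite (size_basis (X := in_tuple b) bA).
have szb' : size b' = \dim (A s.+1) by rewrite (size_basis (X := in_tuple b') bA').
have Ale := homo_leq (@subvv _ _) (@subv_trans _ _) AS.
exists b'; split=> // j; rewrite leq_eqVlt => /predU1P [->|js].
  by rewrite -szb' take_size (span_basis bA').
by rewrite takel_cat ?bt // szb; apply/dimvS/Ale.
Qed.

Section Profile.
Variables (F : finFieldType) (n : nat).
Notation V := 'cV[F]_n.
Notation q := #|F|.
Implicit Types (f p : 'End(V)) (U W : {vspace V}) (mu la : nat -> nat).

(** Recursive form of [krylov], for any endomorphism; [krylovE] identifies the two. *)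
Fixpoint kry f W (j : nat) : {vspace V} :=
  if j is j'.+1 then (W + f @: kry f W j')%VS else 0%VS.

(** Profiles are functions indexed from 0, so [mu 0] is the first part. *)
Definition is_prof f W mu : Prop :=
  forall j, \dim (kry f W j) = \sum_(i < j) mu i.

Definition nprof f U mu : nat :=
  #|[set W : {vspace V} | (W <= U)%VS && `[< is_prof f W mu >]]|.

Lemma kryS f W j : (kry f W j <= kry f W j.+1)%VS.
Proof. by elim: j => [|j IHj]; rewrite ?sub0v //=; apply/addvS/limgS. Qed.

Lemma kry_sub f U W j : (f @: U <= U)%VS -> (W <= U)%VS -> (kry f W j <= U)%VS.
Proof.
move=> fU WU; elim: j => [|j IHj] /=; first exact: sub0v.
by rewrite subv_add WU (subv_trans (limgS f IHj)).
Qed.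

Lemma kry_limg f p U W j : (f @: U <= U)%VS -> (W <= U)%VS ->
    {in U, forall x, p (f x) = f (p x)} ->
  (p @: kry f W j = kry f (p @: W) j)%VS.
Proof.
move=> fU WU pf; elim: j => [|j IHj] /=; first exact: limg0.
rewrite limgD -IHj -!limg_comp; congr addv; apply: eq_in_limg => x xW.
by rewrite !comp_lfunE pf // (subvP (kry_sub j fU WU)).
Qed.

Lemma is_prof_diff f W : is_prof f W (fun j => \dim (kry f W j.+1) - \dim (kry f W j)).
Proof.
elim=> [|j IHj]; first by rewrite big_ord0 dimv0.
by rewrite big_ord_recr -IHj /= subnKC // dimvS // kryS.
Qed.

Lemma is_prof_uniq f W mu la : is_prof f W mu -> is_prof f W la -> mu =1 la.
Proof.
move=> pm pl j; have := pm j.+1; rewrite pl !big_ord_recr /= -pm -pl.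
by move/addnI.
Qed.

Lemma eq_is_prof f W mu la : mu =1 la -> is_prof f W mu -> is_prof f W la.
Proof. by move=> E pm j; rewrite pm; apply: eq_bigr => i _. Qed.

(** * Subspaces of A + E and their projections to A *)

Section Extension.
Variables (f : 'End(V)) (A E : {vspace V}).
Hypotheses (fA : (f @: A <= A)%VS) (Af0 : (A :&: lker f = 0)%VS).
Hypothesis (Ef : (E <= lker f)%VS).
Notation U := (A + E)%VS.
Notation pr := (daddv_pi A E).

Lemma capAE : (A :&: E = 0)%VS.
Proof. by apply/eqP; rewrite -subv0 -Af0 capvS. Qed.

Lemma f_E0 x : x \in E -> f x = 0%R.
Proof. by move=> /(subvP Ef); rewrite memv_ker => /eqP. Qed.

Lemma pr_subE x : x \in U -> (x - pr x)%R \in E.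
Proof. by move=> xU; rewrite -{1}(daddv_pi_add capAE xU) addrC addKr memv_pi. Qed.

Lemma pr_A x : x \in A -> pr x = x.
Proof. exact: (daddv_pi_id capAE). Qed.

Lemma pr_E x : x \in E -> pr x = 0%R.
Proof.
move=> xE; apply/eqP; rewrite -memv0 -capAE memv_cap memv_pi /=.
have xU : x \in U by rewrite (subvP (addvSr _ _)).
by have := memvB xE (pr_subE xU); rewrite opprB addrC subrK.
Qed.

Lemma pr_eq0 x : x \in U -> (pr x == 0%R) = (x \in E).
Proof.
move=> xU; apply/eqP/idP => [p0 | /pr_E //].
by have := pr_subE xU; rewrite p0 subr0.
Qed.

Lemma f_pr x : x \in U -> f (pr x) = f x.
Proof. by move=> /pr_subE /f_E0; rewrite linearB => /eqP; rewrite subr_eq0 => /eqP. Qed.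

Lemma pr_f x : x \in U -> pr (f x) = f (pr x).
Proof. by move=> xU; rewrite -f_pr // pr_A // (subvP fA) // memv_img // memv_pi. Qed.

Lemma fU : (f @: U <= U)%VS.
Proof.
apply/subvP => _ /memv_imgP [x xU ->]; rewrite -f_pr //.
by rewrite (subvP (addvSl _ _)) // (subvP fA) // memv_img // memv_pi.
Qed.

Lemma kry_pr W j : (W <= U)%VS -> (pr @: kry f W j = kry f (pr @: W) j)%VS.
Proof. by move=> WU; apply: (kry_limg (U := U)) => //; [exact: fU | exact: pr_f]. Qed.

Lemma limg_prU W : (pr @: W <= A)%VS.
Proof. by apply/subvP => _ /memv_imgP [x _ ->]; rewrite memv_pi. Qed.

(** As [f] kills [E], only the projection to [A] survives one application of [f]. *)
Lemma kryS_pr W j : (W <= U)%VS -> (kry f W j.+1 = W + f @: kry f (pr @: W) j)%VS.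
Proof.
move=> WU /=; congr addv; rewrite -kry_pr // -limg_comp; apply: eq_in_limg => x xk.
by rewrite comp_lfunE f_pr // (subvP (kry_sub j fU WU)).
Qed.

Lemma dim_pr W : (W <= U)%VS -> \dim (W :&: E) + \dim (pr @: W) = \dim W.
Proof.
move=> WU; rewrite -(limg_ker_dim pr W); congr addn; congr (\dim _).
apply/vspaceP => x; rewrite !memv_cap; case xW: (x \in W) => //=.
by rewrite memv_ker pr_eq0 // (subvP WU).
Qed.

(** Rank-nullity for [pr] on [kry f W j]. *)
Lemma dim_kry_capE W mu la j : (W <= U)%VS ->
    is_prof f W mu -> is_prof f (pr @: W) la ->
  \dim (kry f W j :&: E) + \sum_(i < j) la i = \sum_(i < j) mu i.
Proof. by move=> WU pm pl; rewrite -pl -pm -kry_pr // dim_pr // kry_sub // fU. Qed.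

(** By [dim_kry_capE], [mu j - la j] is the growth of [kry f W j :&: E] from [j] to [j.+1]. *)
Lemma is_prof_pr_le W mu la : (W <= U)%VS ->
  is_prof f W mu -> is_prof f (pr @: W) la -> forall j, la j <= mu j.
Proof.
move=> WU pm pl j; have := dim_kry_capE j WU pm pl; have := dim_kry_capE j.+1 WU pm pl.
have := dimvS (capvS (kryS f W j) (subvv E)); rewrite !big_ord_recr /=; lia.
Qed.

Lemma is_prof_capE W mu la : (W <= U)%VS ->
  is_prof f W mu -> is_prof f (pr @: W) la -> \dim (W :&: E) = mu 0 - la 0.
Proof.
move=> WU pm pl; have := dim_kry_capE 1 WU pm pl.
rewrite !big_ord1 /= limg0 addv0; lia.
Qed.

(** * The flag of a projection and the graphs over it *)

Section Flag.
Variables (W' : {vspace V}) (la : nat -> nat).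
Hypotheses (W'A : (W' <= A)%VS) (prW' : is_prof f W' la).

(** The [w] in [W'] that an element of [f @: kry f W' j] can cancel; on these [h] contributes to the
    intersection with [E]. *)
Definition flag j : {vspace V} := (W' :&: f @: kry f W' j)%VS.

Lemma flagS j : (flag j <= flag j.+1)%VS.
Proof. by apply/capvS/limgS/kryS. Qed.

(** Dimension formula for [W' + f @: kry f W' j]; being injective on [A], [f] preserves the
    dimension of [kry f W' j]. *)
Lemma dim_flag j : \dim (flag j) + la j = la 0.
Proof.
have := dimv_sum_cap W' (f @: kry f W' j).
rewrite -/(flag j) limg_dim_eq; last first.
  by apply/eqP; rewrite -subv0 -Af0 capvS // kry_sub.
have := prW' 1; rewrite /= limg0 addv0 big_ord1 => ->.
have := prW' j.+1; rewrite big_ord_recr /= -prW' => -> H.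
by apply: (@addnI (\dim (kry f W' j))); rewrite [RHS]addnC -H addnA addnAC.
Qed.

Lemma dim_base : \dim W' = la 0.
Proof. by have := prW' 1; rewrite /= limg0 addv0 big_ord1. Qed.

Lemma flag_full j : la j = 0 -> flag j = W'.
Proof.
move=> lj; apply/eqP; rewrite eqEdim capvSl dim_base.
by have := dim_flag j; rewrite lj addn0 => ->; rewrite /= leqnn.
Qed.

Section Graph.
Variables (K : {vspace V}) (h : 'End(V)).
Hypotheses (KE : (K <= E)%VS) (hE : (h @: W' <= E)%VS).

Definition graph : {vspace V} := (K + (\1 + h)%VF @: W')%VS.

Lemma mem_graph x :
  reflect (exists2 k, k \in K & exists2 w, w \in W' & x = (k + (w + h w))%R)
          (x \in graph).
Proof.
apply: (iffP memv_addP) => [[k kK [_ /memv_imgP [w wW ->] ->]] | [k kK [w wW ->]]].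
  by exists k => //; exists w => //; rewrite add_lfunE id_lfunE.
exists k => //; exists (w + h w)%R => //.
by apply/memv_imgP; exists w => //; rewrite add_lfunE id_lfunE.
Qed.

Lemma h_mem w : w \in W' -> h w \in E.
Proof. by move=> wW; rewrite (subvP hE) // memv_img. Qed.

Lemma graph_sub : (graph <= U)%VS.
Proof.
apply/subvP => x /mem_graph [k kK [w wW ->]].
by rewrite addrCA memv_add ?(subvP W'A) // memvD ?h_mem // (subvP KE).
Qed.

Lemma graph_pr : (pr @: graph = W')%VS.
Proof.
have prg k w : k \in K -> w \in W' -> pr (k + (w + h w))%R = w.
  move=> kK wW; rewrite !linearD /= (pr_E (subvP KE _ kK)) (pr_E (h_mem wW)).
  by rewrite add0r addr0 pr_A // (subvP W'A).
apply/vspaceP => x; apply/memv_imgP/idP => [[_ /mem_graph [k kK [w wW ->]] ->] | xW].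
  by rewrite prg.
exists (0 + (x + h x))%R; last by rewrite prg // mem0v.
by apply/mem_graph; exists 0%R; rewrite ?mem0v //; exists x.
Qed.

(** A vector [k + (w + h w) + y] with [y] in [f @: kry f W' j] lies in [E] iff its [A]-component
    [w + y] is 0; then it equals [k + h w], with [w] in the flag step. *)
Lemma kry_graph_capE j : (kry f graph j.+1 :&: E = K + h @: flag j)%VS.
Proof.
rewrite kryS_pr ?graph_sub // graph_pr.
have kA : (f @: kry f W' j <= A)%VS.
  by apply: subv_trans fA; apply/limgS/kry_sub.
apply/vspaceP => x; apply/memv_capP/memv_addP => [[]|].
  move=> /memv_addP [_ /mem_graph [k kK [w wW ->]] [y yk ->]] xE.
  have w0 : (w + y)%R = 0%R.
    have wyA : (w + y)%R \in A by rewrite memvD ?(subvP W'A _ wW) ?(subvP kA _ yk).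
    apply/eqP; rewrite -(pr_A wyA) pr_eq0 ?(subvP (addvSl A E)) //.
    have -> : (w + y = k + (w + h w) + y - (k + h w))%R.
      by rewrite addrCA (addrAC w) addrK.
    by rewrite memvB // memvD ?h_mem // (subvP KE).
  exists k => //; exists (h w).
    rewrite memv_img // memv_cap wW /=.
    by rewrite -(addrK y w) w0 sub0r memvN.
  by rewrite -addrA -addrA (addrC (h w)) (addrA w) w0 add0r.
move=> [k kK [_ /memv_imgP [w /memv_capP [wW wk] ->] ->]]; split.
  have -> : (k + h w = k + (w + h w) - w)%R by rewrite [(w + _)%R]addrC addrA addrK.
  apply: memvB; last by rewrite (subvP (addvSr _ _)).
  by rewrite (subvP (addvSl _ _)) //; apply/mem_graph; exists k => //; exists w.
by rewrite memvD ?h_mem // (subvP KE).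
Qed.

Lemma graph_capE : (graph :&: E = K)%VS.
Proof.
have := kry_graph_capE 0; rewrite /flag /= limg0 capv0 limg0 !addv0; exact.
Qed.

(** The dimension of [kry f graph j.+1] is that of its projection, a partial sum of [la], plus that
    of its intersection with [E], the direct sum of [K] and [h @: flag j]. *)
Lemma graph_prof mu C : (forall j, la j <= mu j) -> \dim K = mu 0 - la 0 ->
    (C :&: K = 0)%VS -> (h @: W' <= C)%VS ->
  is_prof f graph mu <->
  forall j, \dim (h @: flag j) = \sum_(i < j) (mu i.+1 - la i.+1).
Proof.
move=> lm dK CK hC.
have key j : \dim (kry f graph j.+1) + \sum_(i < j) (mu i.+1 - la i.+1) =
             \dim (h @: flag j) + \sum_(i < j.+1) mu i.
  rewrite -(dim_pr (kry_sub j.+1 fU graph_sub)) kry_pr ?graph_sub // graph_pr.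
  rewrite kry_graph_capE prW' dimv_disjoint_sum; last first.
    by apply/eqP; rewrite -subv0 -CK capvC capvS // (subv_trans _ hC) // limgS // capvSl.
  rewrite dK [\sum_(i < j.+1) mu i](eq_bigr (fun i : 'I_j.+1 => la i + (mu i - la i))).
    rewrite big_split /= [\sum_(i < j.+1) (mu i - la i)]big_ord_recl.
    have -> : \sum_(i < j) (mu (lift ord0 i) - la (lift ord0 i)) =
              \sum_(i < j) (mu i.+1 - la i.+1) by [].
    by rewrite [X in X + _ + _]addnC -!addnA; congr addn; rewrite addnCA.
  by move=> i _; rewrite subnKC.
split=> [pm j | ph [|j]]; first by have := key j; rewrite pm addnC => /addIn.
  by rewrite big_ord0 dimv0.
by have := key j; rewrite ph addnC => /addnI.
Qed.

End Graph.
End Flag.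
End Extension.
End Profile.

(** Candidate profiles form a finite type, over which one can sum; [ext] pads them with zeros. *)
Definition ext (s N : nat) (l : {ffun 'I_s -> 'I_N}) (i : nat) : nat :=
  if insub i is Some j then l j : nat else 0.

Lemma ext_ord s N (l : {ffun 'I_s -> 'I_N}) (i : 'I_s) : ext l i = l i.
Proof. by rewrite /ext valK. Qed.

Lemma ext_ge s N (l : {ffun 'I_s -> 'I_N}) i : s <= i -> ext l i = 0.
Proof. by move=> si; rewrite /ext insubN // -leqNgt. Qed.

(** * Counting the subspaces with given projection and given intersection with E *)

Section Count.
Variables (F : finFieldType) (n : nat).
Notation V := 'cV[F]_n.
Notation q := #|F|.
Variables (f : 'End(V)) (A E : {vspace V}).
Hypotheses (fA : (f @: A <= A)%VS) (Af0 : (A :&: lker f = 0)%VS).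
Hypothesis (Ef : (E <= lker f)%VS).
Notation U := (A + E)%VS.
Notation pr := (daddv_pi A E).

(** The rank that [graph_prof] prescribes for [h] on the [j]-th flag step. *)
Definition rise (mu la : nat -> nat) j := \sum_(i < j) (mu i.+1 - la i.+1).

Section Fiber.
Variables (W' K : {vspace V}) (mu la : nat -> nat) (s : nat).
Hypotheses (W'A : (W' <= A)%VS) (prW' : is_prof f W' la) (lm : forall j, la j <= mu j).
Hypotheses (mu0 : forall j, s <= j -> mu j = 0).
Hypotheses (KE : (K <= E)%VS) (dK : \dim K = mu 0 - la 0).
Notation C := (E :\: K)%VS.
Notation p j := (\dim (flag f W' j)).

Lemma capCK : (C :&: K = 0)%VS. Proof. exact: capv_diff. Qed.

Lemma la_ge j : s <= j -> la j = 0.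
Proof. by move=> sj; have := lm j; rewrite mu0 // leqn0 => /eqP. Qed.

(** Here [c] stands for the values of [h] on a basis of [W'] adapted to the flag. *)
Definition flag_cond (c : seq V) : bool := all [in C] c &&
  all (fun j => \dim <<take (p j) c>> == rise mu la j) (iota 0 s.+1).

(** The subspace [graph] read off from a list of values, before any linear map is chosen. *)
Definition span_graph (b c : seq V) : {vspace V} :=
  (K + <<[seq (x.1 + x.2)%R | x <- zip b c]>>)%VS.

Lemma span_graphE b (h : 'End(V)) : <<b>>%VS = W' ->
  span_graph b (map h b) = graph W' K h.
Proof.
move=> bW; rewrite /span_graph /graph -bW limg_span.
rewrite -[X in zip X _](map_id b) zip_map -map_comp.
by congr (_ + <<_>>)%VS; apply: eq_map => x /=; rewrite add_lfunE id_lfunE.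
Qed.

Lemma flag_condP b (h : 'End(V)) : <<b>>%VS = W' ->
    (forall j, j <= s -> <<take (p j) b>>%VS = flag f W' j) ->
  flag_cond (map h b) <-> (h @: W' <= C)%VS /\ is_prof f (graph W' K h) mu.
Proof.
move=> bW bt.
have dt j : j <= s -> <<take (p j) (map h b)>>%VS = (h @: flag f W' j)%VS.
  by move=> js; rewrite -map_take -limg_span bt.
have hW : (h @: W' <= C)%VS <-> all [in C] (map h b).
  rewrite -bW limg_span; split=> [/span_subvP hC|/allP hC]; first exact/allP.
  exact/span_subvP.
have hWE : (h @: W' <= C)%VS -> (h @: W' <= E)%VS.
  by move=> /subv_trans; apply; exact: diffvSl.
split=> [/andP [/hW hC /allP ch] | [hC pg]].
  split=> //; apply: (proj2 (graph_prof fA Af0 Ef W'A prW' KE (hWE hC) lm dK capCK hC)) => j.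
  have small i : i <= s -> \dim (h @: flag f W' i) = rise mu la i.
    by move=> si; rewrite -dt //; apply/eqP/ch; rewrite mem_iota add0n ltnS.
  (* Beyond [s] the flag is all of [W'] and [rise] is constant, since [mu] vanishes there. *)
  have [/small //|/ltnW sj] := leqP j s.
  rewrite (flag_full fA Af0 W'A prW' (la_ge sj)).
  rewrite -(flag_full fA Af0 W'A prW' (la_ge (leqnn s))) small //.
  rewrite /rise -(subnKC sj) big_split_ord /= [X in _ + X]big1 ?addn0 // => i _.
  by rewrite mu0 // -addnS leq_addr.
apply/andP; split; first exact/hW.
apply/allP => j; rewrite mem_iota add0n ltnS => /= js; rewrite dt //.
by apply/eqP; apply: (proj1 (graph_prof fA Af0 Ef W'A prW' KE (hWE hC) lm dK capCK hC)).
Qed.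

Lemma exists_hom (b c : seq V) : free b -> size c = size b ->
  exists h : 'End(V), map h b = c.
Proof.
move=> fb sc; have [h /(_ fb sc) hb] := linear_of_free b c.
by exists (linfun h); rewrite -hb; apply: eq_map => x; rewrite lfunE.
Qed.

(** For an adapted basis [b], [span_graph b] is a bijection from the admissible tuples onto the
    fiber. *)
Lemma card_fiber :
  #|[set W : {vspace V} | [&& (W <= U)%VS, `[< is_prof f W mu >], pr @: W == W' & W :&: E == K]%VS]|
  = ntuples (p s) flag_cond.
Proof.
have [b [bB bt]] := adapted_basis s (flagS f W').
have fs := flag_full fA Af0 W'A prW' (la_ge (leqnn s)).
have szb : size b = p s by rewrite (size_basis (X := in_tuple b) bB).
have bW : <<b>>%VS = W' by rewrite (span_basis bB) fs.
have fb := basis_free bB.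
have b_in x : x \in b -> x \in W' by move=> xb; rewrite -bW memv_span.
have CE : (C <= E)%VS := diffvSl _ _.
have condh (c : (p s).-tuple V) : flag_cond c -> exists h : 'End(V),
    [/\ map h b = c, (h @: W' <= C)%VS, is_prof f (graph W' K h) mu
      & span_graph b c = graph W' K h].
  have [|h hb] := @exists_hom b c fb; first by rewrite size_tuple szb.
  by rewrite -hb => /(flag_condP _ bW bt) [hC pg]; exists h; split; rewrite ?span_graphE.
rewrite /ntuples -big_mkcond sum1dep_card.
rewrite -(card_in_imset (f := fun c : (p s).-tuple V => span_graph b c)); last first.
  (* Injectivity: if the graphs agree, [h x - h' x] lies in the graph and in [E], hence in [K], and
     also in [C], so it is 0. *)
  move=> c c'; rewrite !inE => /condh [h [hb hC _ ->]] /condh [h' [hb' hC' _ ->]] eqg.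
  apply: val_inj; rewrite /= -hb -hb'; apply/eq_in_map => x xb.
  have xW := b_in x xb.
  apply/eqP; rewrite -subr_eq0 -memv0 -capCK memv_cap.
  have hxC : (h x - h' x)%R \in C.
    by rewrite memvB ?(subvP hC _ (memv_img _ _)) ?(subvP hC' _ (memv_img _ _)).
  rewrite hxC /= -(graph_capE fA Af0 Ef W'A KE (subv_trans hC CE)) memv_cap.
  rewrite (subvP CE _ hxC) andbT.
  have -> : (h x - h' x = 0 + (x + h x) - (0 + (x + h' x)))%R.
    by rewrite !add0r opprD addrACA subrr add0r.
  apply: memvB; first by apply/mem_graph; exists 0%R; rewrite ?mem0v //; exists x.
  by rewrite eqg; apply/mem_graph; exists 0%R; rewrite ?mem0v //; exists x.
apply: eq_card => W; rewrite inE; apply/and4P/imsetP => [[WU /asboolP pW /eqP prW /eqP WE]|].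
  (* Surjectivity: [g] is a mere choice, and [h] is the linear map that agrees with it on [b]. The
     graph of [h] lies in [W] and has the same dimension. *)
  pose g x : V := odflt 0%R [pick y | (y \in C) && ((x + y)%R \in W)].
  have gP x : x \in W' -> (g x \in C) && ((x + g x)%R \in W).
    rewrite -prW /g => /memv_imgP [w wW ->]; case: pickP => //.
    have := pr_subE Af0 Ef (subvP WU _ wW).
    rewrite -{2}(addv_diff_cap E K) (capv_idPr KE) => /memv_addP [y yC [k kK e]].
    move=> /(_ y); rewrite yC /=.
    have -> : (pr w + y = w - k)%R.
      by apply/eqP; rewrite eq_sym subr_eq -addrA -e addrC subrK.
    by rewrite memvB // (subvP _ _ kK) // -WE capvSl.
  have sg : size (map g b) == p s by rewrite size_map szb.
  have [|h hb] := @exists_hom b (map g b) fb; first by rewrite size_map.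
  have hg x : x \in b -> h x = g x by move: hb => /eq_in_map; apply.
  have hC : (h @: W' <= C)%VS.
    rewrite -bW limg_span; apply/span_subvP => _ /mapP [x xb ->].
    by rewrite hg //; have /andP [] := gP x (b_in x xb).
  have eW : W = graph W' K h.
    apply/eqP; rewrite eq_sym eqEdim; apply/andP; split.
      rewrite -(span_graphE h bW) // subv_add -{1}WE capvSl /=; apply/span_subvP => z.
      rewrite -[X in zip X _](map_id b) zip_map -map_comp => /mapP [x xb ->] /=.
      by rewrite hg //; have /andP [] := gP x (b_in x xb).
    rewrite -(dim_pr Af0 Ef WU) prW WE.
    have hE := subv_trans hC CE.
    rewrite -(dim_pr Af0 Ef (graph_sub W'A KE hE)).
    by rewrite (graph_pr Af0 Ef W'A KE hE) (graph_capE fA Af0 Ef W'A KE hE).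
  exists (Tuple sg); last by rewrite /= -hb span_graphE.
  by rewrite inE /= -hb; apply/(flag_condP _ bW bt); rewrite -eW.
move=> [c]; rewrite inE => /condh [h [_ hC pg ->]] ->.
have hE := subv_trans hC CE.
split; first exact: graph_sub; first exact/asboolP.
  by rewrite (graph_pr Af0 Ef W'A KE hE).
by rewrite (graph_capE fA Af0 Ef W'A KE hE).
Qed.

(** By [dim_flag] the block lengths are [la j - la j.+1], so of [W'] only its profile matters. *)
Lemma card_fiberE :
  #|[set W : {vspace V} | [&& (W <= U)%VS, `[< is_prof f W mu >], pr @: W == W' & W :&: E == K]%VS]|
  = \prod_(j < s) qext q (\dim E - (mu 0 - la 0)) (rise mu la j)
                       (la j - la j.+1) (mu j.+1 - la j.+1).
Proof.
have pS j : p j <= p j.+1 by apply/dimvS/flagS.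
rewrite card_fiber ntuples_flag //; first last.
- by move=> j; rewrite /rise big_ord_recr leq_addr.
- by rewrite /rise big_ord0.
- by rewrite /flag /= limg0 capv0 dimv0.
have -> : \dim C = \dim E - (mu 0 - la 0).
  by have := dimv_cap_compl E K; rewrite (capv_idPr KE) dK => <-; rewrite addKn.
apply: eq_bigr => j _; congr qext; last by rewrite /rise big_ord_recr /= addKn.
have := dim_flag fA Af0 W'A prW' j; have := dim_flag fA Af0 W'A prW' j.+1; have := pS j.
lia.
Qed.

End Fiber.
End Count.

(** * The recursion that adds one eigenspace *)

Section Recursion.
Variables (F : finFieldType) (n : nat).
Notation V := 'cV[F]_n.
Notation q := #|F|.

Lemma dim_le (W : {vspace V}) : \dim W <= n.
Proof. by have := dimvS (subvf W); rewrite dimvf dim_matrix ?muln1 ?mulr1. Qed.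

(** The subspaces are sorted by the profile of their projection, then by the projection [W'], then
    by the intersection [K] with [E]; the last fibers have the size in [card_fiberE]. *)
Lemma nprof_extend (f : 'End(V)) (A E : {vspace V}) (mu : nat -> nat) s :
    (f @: A <= A)%VS -> (A :&: lker f = 0)%VS -> (E <= lker f)%VS ->
    (forall j, s <= j -> mu j = 0) ->
  nprof f (A + E) mu =
    \sum_(l : {ffun 'I_s -> 'I_n.+1} | [forall i, l i <= mu i])
      nprof f A (ext l) * (qbin q (\dim E) (mu 0 - ext l 0) *
        \prod_(j < s) qext q (\dim E - (mu 0 - ext l 0)) (rise mu (ext l) j)
           (ext l j - ext l j.+1) (mu j.+1 - ext l j.+1)).
Proof.
move=> fA Af0 Ef mu0; set pr := daddv_pi A E.
pose S := [set W : {vspace V} | (W <= A + E)%VS && `[< is_prof f W mu >]].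
pose d (W : {vspace V}) j := \dim (kry f W j.+1) - \dim (kry f W j).
(* [inord] loses nothing, as a difference of dimensions is at most [n]. *)
pose code W : {ffun 'I_s -> 'I_n.+1} := [ffun i : 'I_s => inord (d (pr @: W)%VS i)].
have d_prof W : is_prof f W (d W) by exact: is_prof_diff.
have d_le W : W \in S -> forall j, d (pr @: W)%VS j <= mu j.
  by rewrite inE => /andP [WU /asboolP pW]; apply: (is_prof_pr_le fA Af0 Ef WU pW).
have codeE W : W \in S -> ext (code W) =1 d (pr @: W)%VS.
  move=> WS j; have [js | sj] := ltnP j s; last first.
    by rewrite ext_ge //; have := d_le W WS j; rewrite mu0 // leqn0 => /eqP.
  rewrite -[j]/(val (Ordinal js)) ext_ord ffunE inordK // ltnS.
  by apply: leq_trans (leq_subr _ _) (dim_le _).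
have codeP W l : W \in S -> (code W == l) = `[< is_prof f (pr @: W)%VS (ext l) >].
  move=> WS; apply/eqP/asboolP => [<- | pl].
    by apply: eq_is_prof (d_prof _) => j; rewrite codeE.
  apply/ffunP => i; apply: ord_inj; rewrite -!ext_ord codeE //.
  exact: is_prof_uniq (d_prof _) pl i.
rewrite /nprof -/S -sum1_card (partition_big code (fun l => [forall i, l i <= mu i])) /=; last first.
  by move=> W WS; apply/forallP => i; rewrite -ext_ord codeE // d_le.
apply: eq_bigr => l /forallP lm.
have extm j : ext l j <= mu j.
  have [js | sj] := ltnP j s; last by rewrite ext_ge.
  by rewrite -[j]/(val (Ordinal js)) ext_ord.
set k := mu 0 - ext l 0; set G := \prod_(j < s) _.
pose S' := [set W : {vspace V} | (W <= A)%VS && `[< is_prof f W (ext l) >]].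
pose SK := [set K : {vspace V} | (K <= E)%VS && (\dim K == k)].
rewrite -card_subspaces -/S' -/SK.
rewrite (partition_big (fun W => pr @: W)%VS (mem S')) /=; last first.
  move=> W /andP [WS]; rewrite codeP // => pl.
  by rewrite inE pl andbT; exact: limg_prU.
rewrite -sum_nat_const; apply: eq_bigr => W'; rewrite inE => /andP [W'A /asboolP pW'].
rewrite (partition_big (fun W => W :&: E)%VS (mem SK)) /=; last first.
  move=> W /andP [/andP [WS]]; rewrite codeP // => /asboolP pl _.
  move: WS; rewrite !inE => /andP [WU /asboolP pW].
  by rewrite capvSr (is_prof_capE fA Af0 Ef WU pW pl) eqxx.
rewrite -sum_nat_const; apply: eq_bigr => K; rewrite inE => /andP [KE /eqP dK].
rewrite /G /k -(card_fiberE fA Af0 Ef W'A pW' extm mu0 KE dK) -sum1_card.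
apply: eq_bigl => W; rewrite [RHS]in_set -!andbA.
transitivity [&& W \in S, (pr @: W)%VS == W' & (W :&: E)%VS == K]; last by rewrite in_set -!andbA.
case WS: (W \in S) => //; rewrite codeP //.
by case: ((pr @: W)%VS =P W') => [->|]; rewrite ?andbF //= (asboolT pW').
Qed.

End Recursion.

(** * Polynomials and exponents *)

(** Coefficients in [nat] build in the nonnegativity, so closure under sums and products
    suffices. *)
Definition polyfun (g : nat -> nat) : Prop :=
  exists b : {poly nat}, forall q, (b.[q])%R = g q.

Lemma polyfun_const c : polyfun (fun=> c).
Proof. by exists (c%:P)%R => q; rewrite hornerC. Qed.

Lemma polyfun_id : polyfun id.
Proof. by exists 'X%R => q; rewrite hornerX. Qed.

Lemma polyfunD g h : polyfun g -> polyfun h -> polyfun (fun q => g q + h q).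
Proof. by move=> [b bE] [c cE]; exists (b + c)%R => q; rewrite hornerD bE cE. Qed.

Lemma polyfunM g h : polyfun g -> polyfun h -> polyfun (fun q => g q * h q).
Proof. by move=> [b bE] [c cE]; exists (b * c)%R => q; rewrite hornerM bE cE. Qed.

Lemma polyfun_exp k : polyfun (fun q => q ^ k).
Proof.
elim: k => [|k IHk]; first exact: polyfun_const.
have [b bE] := polyfunM polyfun_id IHk.
by exists b => q; rewrite bE expnS.
Qed.

Lemma polyfun_sum (I : Type) (r : seq I) (P : pred I) (g : I -> nat -> nat) :
  (forall i, polyfun (g i)) -> polyfun (fun q => \sum_(i <- r | P i) g i q).
Proof.
move=> pg; elim: r => [|i r [b bE]].
  by exists 0%R => q; rewrite horner0 big_nil.
have [c cE] := pg i.
exists ((if P i then c else 0) + b)%R => q; rewrite hornerD bE big_cons.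
by case: ifP; rewrite ?cE // horner0 add0r.
Qed.

Lemma polyfun_prod (I : Type) (r : seq I) (P : pred I) (g : I -> nat -> nat) :
  (forall i, polyfun (g i)) -> polyfun (fun q => \prod_(i <- r | P i) g i q).
Proof.
move=> pg; elim: r => [|i r [b bE]].
  by have [b bE] := polyfun_const 1; exists b => q; rewrite bE big_nil.
have [c cE] := pg i; case Pi: (P i); last first.
  by exists b => q; rewrite big_cons Pi.
by have [d dE] := polyfunM (ex_intro _ c cE) (ex_intro _ b bE); exists d => q; rewrite dE big_cons Pi.
Qed.

Lemma polyfun_qint n : polyfun (qint ^~ n).
Proof. by apply: polyfun_sum => i; exact: polyfun_exp. Qed.

Lemma polyfun_qbin m k : polyfun (fun q => qbin q m k).
Proof.
elim: m k => [|m IHm] [|k]; rewrite /=; try exact: polyfun_const.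
exact: polyfunD (IHm k) (polyfunM (polyfun_exp _) (IHm _)).
Qed.

(* What remains of [qbin * \prod_j qext] once the powers of [q - 1] and [q]
   are taken out. *)
Definition step_coef (m s : nat) (mu la : nat -> nat) (q : nat) : nat :=
  qbin q m (mu 0 - la 0) *
  \prod_(j < s) (qbin q (la j - la j.+1) (mu j.+1 - la j.+1) *
    \prod_(i < mu j.+1 - la j.+1) qint q (m - (mu 0 - la 0) - (rise mu la j + i))).

(** The recursion of [nprof_extend] over the multiplicities [nu], freed of the powers of [q - 1] and
    [q]. With no eigenvalue left, only the zero space and the zero profile remain. *)
Fixpoint profile_poly (s N : nat) (nu : seq nat) (mu : nat -> nat) (q : nat) : nat :=
  if nu is m :: nu' then
    \sum_(l : {ffun 'I_s -> 'I_N} | [forall i, l i <= mu i])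
      profile_poly s N nu' (ext l) q * step_coef m s mu (ext l) q
  else [forall i : 'I_s, mu i == 0].

Lemma polyfun_profile_poly s N nu mu : polyfun (profile_poly s N nu mu).
Proof.
elim: nu mu => [|m nu IHnu] mu; first exact: polyfun_const.
apply: polyfun_sum => l; apply: polyfunM; first exact: IHnu.
apply: polyfunM; first exact: polyfun_qbin.
apply: polyfun_prod => j; apply: polyfunM; first exact: polyfun_qbin.
by apply: polyfun_prod => i; exact: polyfun_qint.
Qed.

(** The exponent of [q] collects [(a - e) * r] and the sum of the [r + i] for [i < e]; for [a < e]
    both sides are 0. *)
Lemma qextE q M r a e : 0 < q ->
  qext q M r a e = (q - 1) ^ e * q ^ (a * r + 'C(e, 2)) *
    (qbin q a e * \prod_(i < e) qint q (M - (r + i))).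
Proof.
move=> q_gt0; rewrite /qext; have [ae|ea] := ltnP a e.
  by rewrite qbin_small // mul0n !muln0.
under eq_bigr => i _ do rewrite expn_sub_qint //.
rewrite !big_split /= prod_nat_const card_ord -expn_sum big_split /=.
rewrite sum_nat_const card_ord -(big_mkord xpredT id) bin2_sum.
have -> : a * r + 'C(e, 2) = (a - e) * r + (e * r + 'C(e, 2)).
  by rewrite addnA -mulnDl subnK.
by rewrite (expnD _ ((a - e) * r)); ring.
Qed.

Lemma bin2D l e : 'C(l + e, 2) = 'C(l, 2) + 'C(e, 2) + l * e.
Proof.
elim: e => [|e IHe]; first by rewrite addn0 muln0 !addn0.
by rewrite addnS !binS !bin1 IHe; lia.
Qed.

(** Summation by parts, using [bin2D] for [mu = la + (mu - la)]. The boundary term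
    [la s * rise mu la s] carries the induction and vanishes once [la s = 0]. *)
Lemma exponent_sum (mu la : nat -> nat) s :
    (forall j, la j.+1 <= la j) -> (forall j, la j <= mu j) ->
  \sum_(j < s) ((la j - la j.+1) * rise mu la j + 'C(mu j.+1 - la j.+1, 2)) +
    \sum_(j < s) 'C(la j.+1, 2) + la s * rise mu la s =
  \sum_(j < s) 'C(mu j.+1, 2).
Proof.
move=> laS lm; elim: s => [|s IHs]; first by rewrite /rise !big_ord0 muln0.
rewrite !big_ord_recr /= -IHs.
have -> : rise mu la s.+1 = rise mu la s + (mu s.+1 - la s.+1).
  by rewrite /rise big_ord_recr.
have := bin2D (la s.+1) (mu s.+1 - la s.+1); rewrite subnKC // => ->.
have : (la s - la s.+1) * rise mu la s + la s.+1 * rise mu la s = la s * rise mu la s.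
  by rewrite -mulnDl subnK.
rewrite mulnDr => <-.
move: (la s - _) (_ s.+1 - _) (\sum_(i < s) _) (\sum_(i < s) 'C(la _, 2)) => a e S T; ring.
Qed.

(** * Diagonal matrices *)

Section Diagonal.
Variables (F : finFieldType) (n : nat).
Notation V := 'cV[F]_n.
Notation q := #|F|.

(** For [x] in [kry f W j], both [f x] and [c *: x] lie in [kry f W j.+1]; shifting back by [- c]
    will give equality. *)
Lemma kry_shift_le (f : 'End(V)) (c : F) W j :
  (kry (f + c *: \1%VF)%R W j <= kry f W j)%VS.
Proof.
elim: j => [|j IHj] /=; first exact: sub0v.
rewrite subv_add addvSl /=; apply/subvP => _ /memv_imgP [x xk ->].
have {}xk := subvP IHj _ xk.
rewrite add_lfunE scale_lfunE id_lfunE memvD //.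
  by rewrite (subvP (addvSr _ _)) // memv_img.
by rewrite memvZ // (subvP (kryS f W j)).
Qed.

Lemma kry_shift (f : 'End(V)) (c : F) W j : kry (f + c *: \1%VF)%R W j = kry f W j.
Proof.
apply/eqP; rewrite eqEsubv kry_shift_le /=.
by have := kry_shift_le (f + c *: \1%VF)%R (- c)%R W j; rewrite scaleNr addrK.
Qed.

Lemma nprof_shift (f : 'End(V)) (c : F) U mu :
  nprof (f + c *: \1%VF)%R U mu = nprof f U mu.
Proof.
apply: eq_card => W; rewrite !inE; congr andb; apply: asbool_equiv_eq.
by split=> pW j; have := pW j; rewrite kry_shift.
Qed.

(** The flag increases and its [j]-th step has codimension [la j] in [W]. *)
Lemma nprof_gt0_decr (f : 'End(V)) (A : {vspace V}) la :
    (f @: A <= A)%VS -> (A :&: lker f = 0)%VS -> 0 < nprof f A la ->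
  forall j, la j.+1 <= la j.
Proof.
move=> fA Af0 /card_gt0P [W]; rewrite inE => /andP [WA /asboolP pW] j.
have := dimvS (flagS f W j).
by have := dim_flag fA Af0 WA pW j; have := dim_flag fA Af0 WA pW j.+1; lia.
Qed.

Definition prefactor (s : nat) (mu : nat -> nat) : nat :=
  (q - 1) ^ (\sum_(j < s) mu j.+1) * q ^ (\sum_(j < s) 'C(mu j.+1, 2)).

Lemma prefactor_gt0 s mu : 0 < prefactor s mu.
Proof.
have q_gt1 : 1 < q := finNzRing_gt1 F.
by rewrite muln_gt0 !expn_gt0 subn_gt0 q_gt1 (ltnW q_gt1).
Qed.

(** The exponents of [q - 1] add up termwise, those of [q] by [exponent_sum]. *)
Lemma prefactor_step s m mu la :
    (forall j, la j.+1 <= la j) -> (forall j, la j <= mu j) -> la s = 0 ->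
  prefactor s la * (qbin q m (mu 0 - la 0) *
     \prod_(j < s) qext q (m - (mu 0 - la 0)) (rise mu la j)
           (la j - la j.+1) (mu j.+1 - la j.+1)) =
  prefactor s mu * step_coef m s mu la q.
Proof.
move=> laS lm las; have q_gt0 := ltnW (finNzRing_gt1 F).
under eq_bigr => j _ do rewrite qextE //.
rewrite !big_split /= -!expn_sum /prefactor -(exponent_sum s laS lm) las mul0n addn0.
have -> : \sum_(j < s) mu j.+1 = \sum_(j < s) la j.+1 + \sum_(j < s) (mu j.+1 - la j.+1).
  by rewrite -big_split /=; apply: eq_bigr => j _; rewrite subnKC.
rewrite /step_coef !big_split /= !expnD.
move: (qbin _ _ _) (_ ^ _) (_ ^ _) (_ ^ _) (_ ^ _) (_ ^ _) (\prod_(i < s) _) (\prod_(i < s) _).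
by move=> *; ring.
Qed.

Definition coordsp (P : {set 'I_n}) : {vspace V} := (\sum_(i in P) <[delta_mx i 0%R]>)%VS.

Lemma mem_coordsp (P : {set 'I_n}) (v : V) : reflect (forall i, i \notin P -> v i 0%R = 0%R) (v \in coordsp P).
Proof.
apply: (iffP idP) => [/memv_sumP [u uP ->] i iP | v0].
  rewrite summxE big1 // => j jP; have /vlineP [k ->] := uP j jP.
  by rewrite !mxE; case: eqP jP iP => [->|_] //; rewrite ?mulr0 // => ->.
rewrite [v]matrix_sum_delta (bigID (mem P)) /= [X in (_ + X)%R]big1 ?addr0.
  apply: memv_suml => i iP; rewrite big_ord1 memvZ //.
  by rewrite (subvP (sumv_sup i iP (subvv _))) // memv_line.
by move=> i iP; rewrite big_ord1 v0 // scale0r.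
Qed.

Lemma coordspU (P Q : {set 'I_n}) : (coordsp P + coordsp Q = coordsp (P :|: Q))%VS.
Proof.
apply/eqP; rewrite eqEsubv subv_add; apply/andP; split.
  apply/andP; split; apply/subvP => v /mem_coordsp v0; apply/mem_coordsp => i;
  by rewrite inE negb_or => /andP [iP iQ]; apply: v0.
apply/subv_sumP => i; rewrite inE => /orP [iP|iQ].
  by apply: subv_trans (addvSl _ _); apply: (sumv_sup i).
by apply: subv_trans (addvSr _ _); apply: (sumv_sup i).
Qed.

Lemma coordspT : coordsp setT = fullv.
Proof. by apply/vspaceP => v; rewrite memvf; apply/mem_coordsp => i; rewrite inE. Qed.

(** The upper bounds for [P] and its complement add up to [n], and the two spaces span everything,
    so both bounds are attained. *)
Lemma dim_coordsp (P : {set 'I_n}) : \dim (coordsp P) = #|P|.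
Proof.
have le (Q : {set 'I_n}) : \dim (coordsp Q) <= #|Q|.
  apply: leq_trans (dimv_leq_sum _ _ _) _; rewrite -sum1_card; apply: leq_sum => i _.
  by rewrite dim_vline leq_b1.
have := dimv_add_leqif (coordsp P) (coordsp (~: P)).
rewrite coordspU setUCr coordspT dimvf dim_matrix => -[+ _].
have := le P; have := le (~: P); have := cardsC P; rewrite card_ord mulr1; lia.
Qed.

Variable D : 'M[F]_n.
Hypothesis Ddiag : is_diag_mx D.
Notation f := (linfun (mulmx D) : 'End(V)).

Lemma diagE (v : V) i : (f v) i 0%R = (D i i * v i 0)%R.
Proof.
rewrite lfunE mxE (bigD1 i) //= big1 ?addr0 // => j ji.
by rewrite (is_diag_mxP Ddiag) ?mul0r // eq_sym.
Qed.

Definition eigsp (evs : seq F) : {vspace V} := coordsp [set i | D i i \in evs].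

Definition mult (a : F) : nat := #|[set i | D i i == a]|.

(** Induction on the eigenvalues. [N] is kept apart from [n.+1] because the polynomial has to be
    fixed before the matrix size is introduced. *)
Lemma nprof_diag N evs s mu : N = n.+1 -> uniq evs -> (forall j, s <= j -> mu j = 0) ->
  nprof f (eigsp evs) mu = prefactor s mu * profile_poly s N (map mult evs) mu q.
Proof.
move=> ->; elim: evs mu => [|a evs IH] mu /= => [_ mu0 | /andP [aN ue] mu0].
  have -> : eigsp [::] = 0%VS by rewrite /eigsp /coordsp big1 // => i; rewrite inE.
  have k0 j : kry f 0 j = 0%VS.
    by elim: j => //= j ->; rewrite limg0 addv0.
  case: forallP => [z | nz].
    have z0 j : mu j = 0.
      by have [js|/mu0 //] := ltnP j s; apply/eqP/(z (Ordinal js)).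
    rewrite /prefactor !big1 ?muln1; first by apply: (@eq_card1 _ 0%VS) => W;
      rewrite !inE subv0; case: eqP => //= ->; apply/asboolP => j; rewrite k0 dimv0 big1.
    - by move=> j _; rewrite z0.
    - by move=> j _; rewrite z0.
  rewrite muln0; apply: eq_card0 => W; rewrite !inE subv0; case: eqP => //= ->.
  apply/asboolP => p0; apply: nz => i; have := p0 i.+1.
  by rewrite k0 dimv0 big_ord_recr /= => /esym /eqP; rewrite addn_eq0 => /andP [].
pose g : 'End(V) := (f + (- a) *: \1%VF)%R.
have gE (v : V) i : (g v) i 0%R = ((D i i - a) * v i 0)%R.
  by rewrite add_lfunE mxE diagE scale_lfunE id_lfunE mxE mulNr mulrBl.
have gA : (g @: eigsp evs <= eigsp evs)%VS.
  apply/subvP => _ /memv_imgP [v /mem_coordsp v0 ->]; apply/mem_coordsp => i iP.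
  by rewrite gE v0 // mulr0.
have Ag0 : (eigsp evs :&: lker g = 0)%VS.
  apply/eqP; rewrite -subv0; apply/subvP => v /memv_capP [/mem_coordsp v0].
  rewrite memv_ker memv0 => /eqP gv; apply/eqP/matrixP => i k; rewrite ord1 mxE.
  have [iP|/v0 //] := boolP (i \in [set i | D i i \in evs]).
  have := gE v i; rewrite gv mxE => /esym /eqP; rewrite mulf_eq0 subr_eq0.
  case/orP => [/eqP Da|/eqP //].
  by move: iP aN; rewrite inE Da => ->.
pose E := coordsp [set i | D i i == a].
have Eg : (E <= lker g)%VS.
  apply/subvP => v /mem_coordsp v0; rewrite memv_ker; apply/eqP/matrixP => i k.
  rewrite ord1 gE mxE; have [ia|na] := eqVneq (D i i) a.
    by rewrite ia subrr mul0r.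
  by rewrite v0 ?mulr0 // inE.
have -> : eigsp (a :: evs) = (eigsp evs + E)%VS.
  by rewrite coordspU; congr coordsp; apply/setP => i; rewrite !inE orbC.
rewrite -(nprof_shift f (- a)%R) -/g (nprof_extend gA Ag0 Eg mu0) big_distrr /=.
apply: eq_bigr => l /forallP lm.
have extm j : ext l j <= mu j.
  have [js | sj] := ltnP j s; last by rewrite ext_ge.
  by rewrite -[j]/(val (Ordinal js)) ext_ord.
have Q := IH (ext l) ue (fun j => @ext_ge _ _ l j).
(* If no subspace has profile [ext l], the polynomial value is 0 too, the prefactor being positive.
   Otherwise [ext l] is decreasing, as [prefactor_step] requires. *)
have [z|pos] := posnP (nprof g (eigsp evs) (ext l)).
  rewrite z mul0n; move: z; rewrite nprof_shift Q => /eqP.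
  by rewrite muln_eq0 (gtn_eqF (prefactor_gt0 _ _)) => /eqP ->; rewrite mul0n muln0.
rewrite /E dim_coordsp -/(mult a).
have dec := nprof_gt0_decr gA Ag0 pos.
rewrite nprof_shift Q mulnAC (prefactor_step _ dec extm) ?ext_ge //.
by rewrite mulnAC -mulnA.
Qed.

Lemma krylovE W j : krylov D W j = kry f W j.
Proof.
elim: j => [|j IHj]; first by rewrite /krylov big_ord0.
rewrite /= -IHj /krylov big_ord_recl limg_sum /=; congr (_ + _)%VS.
  rewrite expr0; have -> : linfun (mulmx 1) = \1%VF :> 'End(V); last exact: lim1g.
  by apply/lfunP => x; rewrite id_lfunE lfunE /= mul1mx.
apply: eq_bigr => i _; rewrite -limg_comp; congr (_ @: _)%VS.
by apply/lfunP => x; rewrite comp_lfunE !lfunE /= exprS mulmxA.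
Qed.

Lemma sigmaE mu : sigma mu D = nprof f fullv (nth 0 mu).
Proof.
apply: eq_card => W; rewrite !inE subvf /=; apply: asbool_equiv_eq.
split=> [pW [|j] | pW j _]; last by rewrite krylovE pW.
  by rewrite big_ord0 dimv0.
by rewrite -krylovE pW.
Qed.

Lemma count_mem_diag a : count_mem a (diag_entries D) = mult a.
Proof.
rewrite /diag_entries count_map -size_filter /mult cardE; congr size.
by rewrite [in RHS]/enum_mem -enumT; apply: eq_filter => i; rewrite /= inE.
Qed.

Lemma eigsp_full evs : evs =i diag_entries D -> eigsp evs = fullv.
Proof.
move=> evsE; rewrite -coordspT; congr coordsp; apply/setP => i.
by rewrite !inE evsE; apply/mapP; exists i; rewrite ?mem_enum.
Qed.

(** Sorting the eigenvalues by multiplicity puts the multiplicities in the order of the type. *)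
Lemma diag_typeP : exists evs, [/\ uniq evs, evs =i diag_entries D & diag_type D = map mult evs].
Proof.
pose r a b := geq (mult a) (mult b).
exists (sort r (undup (diag_entries D))); split.
- by rewrite sort_uniq undup_uniq.
- by move=> a; rewrite mem_sort mem_undup.
rewrite /diag_type (eq_map count_mem_diag) sort_map; congr map.
Qed.

End Diagonal.

Theorem theorem1p5 (mu nu : seq nat) (hmu : is_intpart mu)
    (hnu : is_intpart nu) :
  exists b : {poly nat},
    forall (F : finFieldType) (n : nat) (D : 'M[F]_n),
      n = sumn nu -> is_diag_mx D -> diag_type D = nu ->
      sigma mu D =
        ((#|F| - 1) ^ (\sum_(1 <= j < size mu) nth 0 mu j) *
         #|F| ^ (\sum_(1 <= j < size mu) 'C(nth 0 mu j, 2)) *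
         b.[#|F|]%R)%N.
Proof.
(* The polynomial depends on [mu] and [nu] only; [sumn nu] takes the place of [n]. *)
have [b bE] := polyfun_profile_poly (size mu) (sumn nu).+1 nu (nth 0 mu).
exists b => F n D nE Ddiag Dnu.
have [evs [ue evsE typeE]] := diag_typeP D.
have mu0 j : size mu <= j -> nth 0 mu j = 0 by move=> ?; rewrite nth_default.
(* The right side has one more term, at index [size mu], where the part is 0. *)
have shift (g : nat -> nat) : g 0 = 0 ->
    \sum_(1 <= j < size mu) g (nth 0 mu j) = \sum_(j < size mu) g (nth 0 mu j.+1).
  case: (size mu) mu0 => [|s] mu0 g0; first by rewrite big_geq ?big_ord0.
  by rewrite big_add1 big_mkord big_ord_recr /= mu0 // g0 addn0.
rewrite sigmaE -(eigsp_full evsE) (nprof_diag Ddiag (N := (sumn nu).+1) _ ue mu0) ?nE //.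
by rewrite -typeE Dnu bE (shift id) // (shift (fun x => 'C(x, 2))).
Qed.
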